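(* For the centered standard simplex $S_n=(n+1)\Delta_n-(1,\dots,1)\subset\mathbb R^n$ and every positive integer $k$, \[ \delta\bigl(\mathbb Z^n\cap\operatorname{int}(kS_n)\bigr)=(n+1)k-n. \] In particular, $\lim_{k\to\infty}\delta\bigl(\mathbb Z^n\cap\operatorname{int}(kS_n)\bigr)/k=n+1$.
   Context: $\Delta_n=\operatorname{conv}\{0,e_1,\dots,e_n\}$, with $e_1,\dots,e_n$ the standard basis of $\mathbb R^n$. For a finite set $S\subset\mathbb R^n$, $\delta(S)$ denotes the least total degree of a nonzero real polynomial in $n$ variables vanishing at every point of $S$. *)

(* Defs.v *)
From HB Require Import structures.
From mathcomp Require Import all_boot all_order all_algebra.
From mathcomp Require Import boolp classical_sets functions cardinality reals.
From mathcomp Require Import topology normedtype sequences convex.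
(* The notations of mpoly clash with those of MathComp-Analysis. *)
From mathcomp Require Import -(notations) mpoly.

Set Implicit Arguments.
Unset Strict Implicit.
Unset Printing Implicit Defensive.

Import Order.TTheory GRing.Theory Num.Theory numFieldNormedType.Exports.

Local Open Scope classical_set_scope.
Local Open Scope ring_scope.

Definition convex_hull (R : realType) (n : nat) (A : set 'rV[R]_n) :
  set 'rV[R]_n := smallest (@convex_set R 'rV[R]_n) A.

Definition std_simplex (R : realType) (n : nat) : set 'rV[R]_n :=
  convex_hull ([set 0] `|` range (fun i : 'I_n => delta_mx 0 i)).
Arguments std_simplex : clear implicits.

Definition dilate (R : realType) (n : nat) (a : R) (A : set 'rV[R]_n) :
  set 'rV[R]_n := [set a *: x | x in A].

Definition centered_simplex (R : realType) (n : nat) : set 'rV[R]_n :=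
  [set x - const_mx 1 | x in dilate n.+1%:R (std_simplex R n)].
Arguments centered_simplex : clear implicits.

Definition integer_points (R : realType) (n : nat) : set 'rV[R]_n :=
  [set x | forall i, x 0 i \is a Num.int].
Arguments integer_points : clear implicits.

Definition vanishes_on (R : realType) (n : nat) (p : mpoly n R)
    (S : set 'rV[R]_n) : Prop :=
  forall x, S x -> meval (x 0) p = 0.

(* mmeasure mdeg p is msize p, i.e. 1 + deg p when p != 0. *)
Definition total_degree (R : realType) (n : nat) (p : mpoly n R) : nat :=
  (mmeasure mdeg p).-1.

Definition vanishing_degrees (R : realType) (n : nat) (S : set 'rV[R]_n) :
  set nat := [set total_degree p | p in [set p | p != 0 /\ vanishes_on p S]].

(* The default value 0 is only reached when no nonzero polynomial vanishes on
   S, which cannot happen for S finite and n > 0. *)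
Definition delta (R : realType) (n : nat) (S : set 'rV[R]_n) : nat :=
  xget 0%N [set d | vanishing_degrees S d /\
                    forall e, vanishing_degrees S e -> (d <= e)%N].

Lemma deltaP (R : realType) (n : nat) (S : set 'rV[R]_n) :
  vanishing_degrees S !=set0 ->
  vanishing_degrees S (delta S) /\
  forall e, vanishing_degrees S e -> (delta S <= e)%N.
Proof.
move=> [d Sd]; rewrite /delta; case: xgetP => //= noleast; exfalso.
have exd : exists d, `[< vanishing_degrees S d >] by exists d; apply/asboolP.
case: (ex_minnP exd) => m /asboolP Sm m_min.
by apply: (noleast m); split=> // e Se; apply/m_min/asboolP.
Qed.

Lemma vanishing_degrees_neq0 (R : realType) (n : nat) (S : set 'rV[R]_n) :
  (0 < n)%N -> finite_set S -> vanishing_degrees S !=set0.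
Proof.
move=> n_gt0 /finite_seqP[s ->]; pose i := Ordinal n_gt0.
pose p : mpoly n R := \prod_(x <- s) (mpolyX R (mnm1 i) - mpolyC n (x 0 i)).
exists (total_degree p), p => //; split.
  rewrite /p prodf_seq_neq0; apply/allP => x _ /=.
  rewrite subr_eq0; apply/eqP => /(congr1 (fun q => mcoeff (mnm1 i) q)).
  rewrite mcoeffC mcoeffX eqxx mnm1_eq0 mulr0 => /eqP.
  by rewrite oner_eq0.
move=> x /= xs; rewrite /p rmorph_prod /= (big_rem x) //=.
by rewrite mevalB mevalXU mevalC subrr mul0r.
Qed.

(* Main.v *)
Require Import Defs.
From HB Require Import structures.
From mathcomp Require Import all_boot all_order all_algebra.
From mathcomp Require Import boolp classical_sets functions cardinality reals.
From mathcomp Require Import topology normedtype sequences convex.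
From mathcomp Require Import -(notations) mpoly.
From mathcomp Require Import interval_inference lra.

(** The interior of k S_n is cut out by the strict inequalities - k < x_i and
    sum_i x_i < k.  On integer points the first ones say that
    z_i := x_i + (k - 1) is a natural number, and the last one becomes
    sum_i z_i <= (n + 1) (k - 1).  So the integer points in the interior are
    the translate of the lattice simplex
      T_d = {z in N^n | sum_i z_i <= d},   d = (n + 1) (k - 1),
    and it remains to see that delta (T_d) = d + 1, because
    (n + 1) (k - 1) + 1 = (n + 1) k - n.

    - Upper bound: a coordinate takes only d + 1 values on T_d, so a product of
      d + 1 factors in one variable vanishes there.
    - Lower bound ([mpoly_vanish_on_simplex_eq0]): let X^m be the leading
      monomial of a nonzero p of degree at most d.  The m_i-th divided
      difference in the variable X_i kills the powers X_i^e with e < m_i and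
      maps X_i^(m_i) to 1.  The product of these functionals over i therefore
      kills every monomial of p other than X^m, since an exponent e <> m with
      |e| <= |m| has some e_i < m_i; its value on p is the leading coefficient.
      But this product only reads the values of p on the box prod_i {0..m_i},
      which lies in T_d.  So p cannot vanish on T_d.

    The limit then follows from ((n + 1) k - n) / k = n + 1 - n / k. *)

Set Implicit Arguments.
Unset Strict Implicit.
Unset Printing Implicit Defensive.

Import Order.TTheory GRing.Theory Num.Theory numFieldNormedType.Exports.

Local Open Scope classical_set_scope.
Local Open Scope ring_scope.

(** * Polynomials vanishing on a lattice simplex *)

(** The divided difference at [a 0], ..., [a m] as a linear functional: it reads
    off the coefficient of X^m of a polynomial of degree at most m.  The weights
    solve a Vandermonde system. *)
Lemma divided_difference (F : fieldType) (a : nat -> F) (m : nat) :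
  injective a ->
  exists w : nat -> F, forall e, (e <= m)%N ->
    \sum_(j < m.+1) w j * a j ^+ e = (e == m)%:R.
Proof.
move=> a_inj; pose V := Vandermonde m.+1 (\row_(j < m.+1) a j).
have V_unit : V \in unitmx.
  rewrite unitmxE det_Vandermonde unitfE.
  apply/prodf_neq0 => i _; apply/prodf_neq0 => j ij; rewrite !mxE subr_eq0.
  by apply/eqP => /a_inj eq_ji; rewrite eq_ji ltnn in ij.
pose u : 'cV[F]_m.+1 := invmx V *m delta_mx ord_max 0.
exists (fun j => u (inord j) 0) => e le_em.
have /matrixP/(_ (inord e) 0) : V *m u = delta_mx ord_max 0 by rewrite mulKVmx.
rewrite !mxE andbT -val_eqE /= inordK // => <-.
by apply: eq_bigr => j _; rewrite !mxE inord_val inordK // mulrC.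
Qed.

(** Lattice simplices determine polynomials of degree at most d.  Each
    coordinate may have its own sequence of distinct nodes, because divided
    differences are available for any nodes. *)
Lemma mpoly_vanish_on_simplex_eq0 (F : fieldType) (n d : nat)
    (a : 'I_n -> nat -> F) (p : mpoly n F) :
  (forall i, injective (a i)) -> (mmeasure mdeg p <= d.+1)%N ->
  (forall z : 'I_n -> nat, (\sum_i z i <= d)%N ->
     meval (fun i => a i (z i)) p = 0) ->
  p = 0.
Proof.
move=> a_inj le_pd p_vanish; apply/eqP; apply/negPn/negP => p_neq0.
pose m := mlead p.
have le_md : (mdeg m <= d)%N by rewrite -ltnS (leq_trans _ le_pd) // mlead_deg.
have le_mi i : (m i < d.+1)%N.
  by rewrite ltnS (leq_trans _ le_md) // mdegE (bigD1 i) //= leq_addr.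
have /choice[w wP] : forall i, exists w : nat -> F, forall e, (e <= m i)%N ->
    \sum_(j < (m i).+1) w j * a i j ^+ e = (e == m i)%:R.
  by move=> i; apply: divided_difference.
(* The box prod_i {0..m_i} is a family inside the fixed type {0..d}^n, so that
   the product of sums over its sides can be expanded. *)
pose Q i := [pred j : 'I_d.+1 | (j < (m i).+1)%N].
pose grid := family Q.
(* The product of the divided differences, applied to the monomial X^e. *)
have extract (e : multinom n) : e \in msupp p ->
    \sum_(f in grid) \prod_i (w i (f i) * a i (f i) ^+ e i) = (e == m)%:R.
  move=> e_p; rewrite -(bigA_distr_big_dep _
    (fun i (j : 'I_d.+1) => w i j * a i j ^+ e i)) /=.
  under eq_bigr => i _ do
    rewrite -(big_ord_widen _ (fun j => w i j * a i j ^+ e i)) //.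
  have [-> | ne_em] := eqVneq e m.
    by rewrite big1 // => i _; rewrite wP // eqxx.
  have [i lt_i] : exists i, (e i < m i)%N.
    apply/existsP; apply: contraNT ne_em => /existsPn le_me; apply/eqP.
    have le_m i : (m i <= e i)%N by rewrite leqNgt le_me.
    (* e >= m coordinatewise and |e| <= |m| force e = m. *)
    have eq_deg : (\sum_i m i == \sum_i e i)%N.
      rewrite eqn_leq leq_sum //= -!mdegE -ltnS.
      by rewrite mlead_deg // msize_mdeg_lt.
    apply/mnmP => i; apply/esym/eqP; move: eq_deg.
    have := @leqif_sum _ xpredT _ _ _ (fun i _ => leqif_eq (le_m i)).
    by move=> [_ ->] /forallP /(_ i).
  by rewrite (bigD1 i) //= wP 1?ltnW // ltn_eqF // mul0r.
(* The same functional applied to p, whose values on the box are zero;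
   expanding p into monomials turns this into the leading coefficient. *)
have : \sum_(f in grid) (\prod_i w i (f i)) * meval (fun i => a i (f i)) p = 0.
  apply: big1 => f /familyP f_grid; rewrite p_vanish ?mulr0 //.
  rewrite (leq_trans _ le_md) // mdegE leq_sum // => i _.
  by have := f_grid i; rewrite inE ltnS.
under eq_bigr => f _ do rewrite mevalE mulr_sumr.
rewrite exchange_big /=.
rewrite (eq_big_seq (fun e => mcoeff e p * (e == m)%:R)); last first.
  move=> e e_p; rewrite -extract // mulr_sumr; apply: eq_bigr => f _.
  by rewrite mulrCA -big_split.
rewrite (bigD1_seq m) ?msupp_uniq ?mlead_supp //= eqxx mulr1 big1 ?addr0.
  by move/eqP; rewrite mleadc_eq0 (negPf p_neq0).
by move=> e /negPf ->; rewrite mulr0.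
Qed.

Lemma delta_lattice_simplex (R : realType) (n d : nat) (a : 'I_n -> nat -> R)
    (S : set 'rV[R]_n) :
  (0 < n)%N -> (forall i, injective (a i)) ->
  (forall x, S x <-> exists2 z : 'I_n -> nat,
     (\sum_i z i <= d)%N & forall i, x 0 i = a i (z i)) ->
  delta S = d.+1.
Proof.
move=> n_gt0 a_inj SP; pose i0 := Ordinal n_gt0.
(* The upper bound is reached in the first variable alone. *)
pose lin j : mpoly n R := mpolyX R (mnm1 i0) - mpolyC n (a i0 j).
have lin_size j : mmeasure mdeg (lin j) = 2%N.
  apply/eqP; rewrite eqn_leq; apply/andP; split.
    apply: leq_trans (msizeD_le _ _) _.
    by rewrite msizeN msizeX msizeC mdeg1 geq_max; case: eqP.
  (* A constant has no coefficient at X_0, where lin j has 1. *)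
  rewrite ltnNge; apply/negP => /msize1_polyC lin_const.
  have := congr1 (mcoeff (mnm1 i0)) lin_const.
  rewrite mcoeffB mcoeffX !mcoeffC eqxx mnm1_eq0 !mulr0 subr0 => /eqP.
  by rewrite oner_eq0.
have lin_neq0 j : lin j != 0 by rewrite -msize_poly_eq0 lin_size.
have prod_neq0 r : \prod_(j < r) lin j != 0 by apply/prodf_neq0.
have prod_size r : mmeasure mdeg (\prod_(j < r) lin j) = r.+1.
  elim: r => [|r IHr]; first by rewrite big_ord0 msize1.
  rewrite big_ord_recr (msizeM (prod_neq0 r) (lin_neq0 r)) lin_size.
  by rewrite -[X in (X + _)%N]/(mmeasure mdeg (\prod_(j < r) lin j)) IHr addn2.
have S_deg : vanishing_degrees S d.+1.
  exists (\prod_(j < d.+1) lin j); last by rewrite /total_degree prod_size.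
  split=> // x /SP[z le_zd xz]; rewrite rmorph_prod /=.
  have lt_z0d : (z i0 < d.+1)%N.
    by rewrite ltnS (leq_trans _ le_zd) // (bigD1 i0) //= leq_addr.
  rewrite (bigD1 (Ordinal lt_z0d)) //= mevalB mevalXU mevalC xz subrr.
  by rewrite mul0r.
have [|[p [p_neq0 p_vanish] deg_p] delta_min] := @deltaP R n S.
  by exists d.+1.
apply/eqP; rewrite eqn_leq delta_min //= ltnNge; apply: contra p_neq0.
rewrite -deg_p => le_pd; apply/eqP.
apply: (@mpoly_vanish_on_simplex_eq0 _ _ d a) => // [|z le_zd].
  by rewrite (leq_trans (leqSpred _)).
have := p_vanish (\row_i a i (z i)); rewrite /= => <-.
  by apply: meval_eq => i; rewrite mxE.
by apply/SP; exists z => // i; rewrite mxE.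
Qed.

(** * The centered simplex and its interior *)

(** The inequalities are convex and hold at the vertices, which gives one
    direction.  For the other, a point is built from the vertices one coordinate
    at a time: if only the coordinates up to m are nonzero and t is the m-th one,
    then for t < 1 the point is t e_m + (1 - t) y, where y lies in the simplex
    on the coordinates before m. *)
Lemma std_simplexP (R : realType) (n : nat) (x : 'rV[R]_n) :
  std_simplex R n x <-> (forall i, 0 <= x 0 i) /\ \sum_i x 0 i <= 1.
Proof.
split.
  have : std_simplex R n `<=` [set y : 'rV[R]_n |
    (forall i, 0 <= y 0 i) /\ \sum_i y 0 i <= 1]; last exact.
  apply: smallest_sub.
    move=> u v t /set_mem[u_ge0 u_le1] /set_mem[v_ge0 v_le1]; apply/mem_set.
    have t_ge0 : 0 <= t%:num :> R by [].
    have t_le1 : t%:num <= 1 :> R by [].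
    have s_ge0 : 0 <= 1 - t%:num :> R by rewrite subr_ge0.
    split=> [i|]; rewrite /conv /=.
      by rewrite !mxE addr_ge0 // mulr_ge0.
    under eq_bigr => i _ do rewrite !mxE.
    rewrite big_split /= -!mulr_sumr.
    apply: (@le_trans _ _ (t%:num * 1 + (1 - t%:num) * 1)).
      by apply: lerD; apply: ler_wpM2l.
    by rewrite !mulr1 subrKC.
  move=> _ [->|[i _ <-]] /=; split=> [j|].
  - by rewrite mxE.
  - by rewrite big1 // => j _; rewrite mxE.
  - by rewrite mxE ler0n.
  - rewrite (bigD1 i) //= mxE !eqxx big1 ?addr0 // => j /negPf ne_ji.
    by rewrite mxE ne_ji andbF.
move=> [x_ge0 x_le1] C [C_convex C_vert].
have C0 : 0 \in C by apply/mem_set/C_vert; left.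
have Cdelta i : delta_mx 0 i \in C by apply/mem_set/C_vert; right; exists i.
apply: set_mem.
(* Induction on the number m of coordinates allowed to be nonzero. *)
suff supp_ind m (y : 'rV[R]_n) : (forall i : 'I_n, (m <= i)%N -> y 0 i = 0) ->
    (forall i, 0 <= y 0 i) -> \sum_i y 0 i <= 1 -> y \in C.
  by apply: (supp_ind n) => // i; rewrite leqNgt ltn_ord.
elim: m y {x x_ge0 x_le1} => [|m IHm] x.
  by move=> x0 _ _; suff -> : x = 0 by []; apply/rowP => i; rewrite mxE x0.
move=> xm x_ge0 x_le1.
have [lt_mn|le_nm] := ltnP m n; last first.
  apply: IHm => // i le_mi; have := ltn_ord i.
  by rewrite ltnNge (leq_trans le_nm).
pose i0 := Ordinal lt_mn; pose t := x 0 i0.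
pose y := x - t *: delta_mx 0 i0.
have yE j : y 0 j = if j == i0 then 0 else x 0 j.
  rewrite !mxE eqxx /=; case: eqP => [->|_]; first by rewrite mulr1 subrr.
  by rewrite mulr0 subr0.
have y_ge0 j : 0 <= y 0 j by rewrite yE; case: ifP.
have sum_y : \sum_j y 0 j <= 1 - t.
  rewrite lerBrDl; apply: le_trans x_le1; rewrite [leRHS](bigD1 i0) //= lerD2l.
  rewrite (bigD1 i0) //= yE eqxx add0r le_eqVlt; apply/orP; left; apply/eqP.
  by apply: eq_bigr => j /negPf ne_j; rewrite yE ne_j.
have t_le1 : t <= 1.
  by rewrite -subr_ge0 (le_trans _ sum_y) // sumr_ge0.
have := t_le1; rewrite le_eqVlt => /predU1P[t1|t_lt1].
  suff -> : x = delta_mx 0 i0 by [].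
  (* If t = 1, nothing is left for the other coordinates. *)
  suff y0 : y = 0.
    by move/eqP: y0; rewrite subr_eq0 t1 scale1r => /eqP.
  apply/rowP => j; rewrite [RHS]mxE; apply/eqP.
  rewrite eq_le y_ge0 andbT; apply: le_trans (_ : \sum_i y 0 i <= 0).
    by rewrite (bigD1 j) //= lerDl sumr_ge0.
  by rewrite (le_trans sum_y) // t1 subrr.
have s_gt0 : 0 < 1 - t by rewrite subr_gt0.
have Cy : (1 - t)^-1 *: y \in C.
  apply: IHm => [j le_mj|j|].
  - rewrite [LHS]mxE yE.
    case: eqP => [_|/eqP ne_j]; first by rewrite mulr0.
    rewrite xm ?mulr0 // ltn_neqAle le_mj andbT.
    apply: contraNneq ne_j => eq_mj.
    by apply/eqP/val_inj.
  - by rewrite mxE mulr_ge0 // invr_ge0 ltW.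
  - under eq_bigr => j _ do rewrite mxE.
    by rewrite -mulr_sumr ler_pdivrMl // mulr1.
have := C_convex _ _ (Itv01 (x_ge0 i0) t_le1) (Cdelta i0) Cy; rewrite /conv /=.
by rewrite scalerA divff ?gt_eqF // scale1r /y addrC subrK.
Qed.

Lemma dilate_centered_simplexP (R : realType) (n : nat) (c : R)
    (x : 'rV[R]_n) : 0 < c ->
  dilate c (centered_simplex R n) x <->
  (forall i, - c <= x 0 i) /\ \sum_i x 0 i <= c.
Proof.
move=> c_gt0; have n1_gt0 : 0 < n.+1%:R :> R by rewrite ltr0n.
have sumB (u : 'rV[R]_n) :
    \sum_i (c * (n.+1%:R * u 0 i - 1)) = c * (n.+1%:R * \sum_i u 0 i - n%:R).
  by rewrite -mulr_sumr sumrB -mulr_sumr sumr_const card_ord.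
split=> [[_ [_ [u /std_simplexP[u_ge0 u_le1] <-] <-] <-]|[x_ge x_le]].
  split=> [i|].
    rewrite !mxE -[leLHS]mulrN1 ler_pM2l // lerBrDr addNr.
    by rewrite mulr_ge0 // ltW.
  under eq_bigr => i _ do rewrite !mxE.
  rewrite sumB -[leRHS]mulr1 ler_pM2l // lerBlDr.
  by rewrite -natr1 addrC ger_pMr ?ltr0n // -natr1.
pose u : 'rV[R]_n := \row_i ((x 0 i / c + 1) / n.+1%:R).
have uE i : x 0 i = c * (n.+1%:R * u 0 i - 1).
  by rewrite mxE mulrCA divff ?gt_eqF // mulr1 addrK mulrC divfK // gt_eqF.
exists (n.+1%:R *: u - const_mx 1); last by apply/rowP => i; rewrite uE !mxE.
exists (n.+1%:R *: u) => //; exists u => //; apply/std_simplexP; split=> [i|].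
  rewrite mxE divr_ge0 ?ler0n //.
  by rewrite -lerBlDr sub0r ler_pdivlMr // mulN1r.
move: x_le; under eq_bigr => i _ do rewrite uE.
rewrite sumB -[leRHS]mulr1 ler_pM2l // lerBlDr -natr1 [1 + _]addrC.
by rewrite ger_pMr // ltr_wpDl.
Qed.

(** The strict inequalities define an open set.  Conversely, an interior point
    can be moved both ways along (1, ..., 1); moving down makes the coordinate
    inequalities strict, and moving up does so for the sum because n > 0. *)
Lemma interior_dilate_centered_simplexP (R : realType) (n : nat) (c : R)
    (x : 'rV[R]_n) : (0 < n)%N -> 0 < c ->
  interior (dilate c (centered_simplex R n)) x <->
  (forall i, - c < x 0 i) /\ \sum_i x 0 i < c.
Proof.
move=> n_gt0 c_gt0; split=> [|[x_gt x_lt]].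
  rewrite /interior /= => /nbhs_ballP[e /= e_gt0 x_e].
  have shift (h : R) : `|h| < e ->
      (forall i, - c <= x 0 i + h) /\ \sum_i x 0 i + n%:R * h <= c.
    move=> h_lt; have /x_e/(dilate_centered_simplexP _ c_gt0)[] :
      ball x e (x + const_mx h).
      by split=> // i j; rewrite !mxE /ball /= opprD addNKr normrN.
    move=> ge le; split=> [i|]; first by have := ge i; rewrite !mxE.
    move: le; under eq_bigr => i _ do rewrite !mxE.
    by rewrite big_split /= sumr_const card_ord mulr_natl.
  have h_gt0 : 0 < e / 2 by rewrite divr_gt0.
  have h_lt : e / 2 < e by rewrite ltr_pdivrMr // ltr_pMr // ltr1n.
  split=> [i|].
    have [|/(_ i) + _] := shift (- (e / 2)); first by rewrite normrN gtr0_norm.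
    by move/le_lt_trans; apply; rewrite gtrDl oppr_lt0.
  have [|_] := shift (e / 2); first by rewrite gtr0_norm.
  by apply: lt_le_trans; rewrite ltrDl mulr_gt0 // ltr0n.
have coord i : (fun y : 'rV[R]_n => y 0 i) y @[y --> x] --> x 0 i.
  exact: coord_continuous.
have coords_gt : nbhs x [set y : 'rV[R]_n | forall i, - c < y 0 i].
  pose above i := [set y : 'rV[R]_n | - c < y 0 i].
  have above_near i : nbhs x (above i) by apply: (cvgr_gt _ (coord i)).
  exact: (@filter_forall _ _ above (nbhs x) _ above_near).
have sum_lt : nbhs x [set y : 'rV[R]_n | \sum_i y 0 i < c].
  have sum_cvg : (\sum_i y 0 i) @[y --> x] --> \sum_i x 0 i.
    by apply: cvg_big => [|i _]; [exact: add_continuous | exact: coord].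
  by apply: (cvgr_lt _ sum_cvg).
rewrite /interior /=; near=> y.
apply/dilate_centered_simplexP => //; split=> [i|]; apply: ltW.
  by move: i; near: y.
by near: y.
Unshelve. all: by end_near.
Qed.

(** Integrality turns - (k + 1) < x_i into - k <= x_i, and in terms of
    z_i = x_i + k the bound on the sum becomes sum_i z_i < n k + k + 1. *)
Lemma integer_interiorP (R : realType) (n k : nat) (x : 'rV[R]_n) :
  (0 < n)%N ->
  (integer_points R n `&`
     interior (dilate k.+1%:R (centered_simplex R n))) x <->
  exists2 z : 'I_n -> nat,
    (\sum_i z i <= n.+1 * k)%N & forall i, x 0 i = (z i)%:R - k%:R.
Proof.
move=> n_gt0; rewrite /setI /=.
rewrite (propext (interior_dilate_centered_simplexP _ n_gt0 (ltr0Sn R k))).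
have sumE (z : 'I_n -> nat) : (\sum_i ((z i)%:R - k%:R) < k.+1%:R :> R) =
    (\sum_i z i <= n.+1 * k)%N.
  rewrite sumrB sumr_const card_ord ltrBlDr -natr_sum -mulrnA -natrD ltr_nat.
  by rewrite addSn ltnS mulSn mulnC.
split=> [[x_int [x_gt x_lt]]|[z z_le xE]]; last first.
  split=> [i|]; first by rewrite xE rpredB // intr_nat // natr_nat.
  split=> [i|]; last by under eq_bigr => i _ do rewrite xE; rewrite sumE.
  by rewrite xE -natr1 opprD addrC ltrD2r (lt_le_trans (ltrN10 _)) // ler0n.
have /choice[z zE] : forall i, exists z : nat, x 0 i + k%:R = z%:R.
  move=> i; apply/natrP.
  have : x 0 i + k%:R \is a Num.int.
    by rewrite rpredD ?natr_int //; exact: x_int.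
  rewrite natrEint => /[dup] /intrP[m mE] -> /=.
  rewrite mE ler0z -ltzD1 -(ltr_int R) intrD -mE.
  by have := x_gt i; rewrite -natr1; lra.
have xE i : x 0 i = (z i)%:R - k%:R by rewrite -zE addrK.
exists z => //; rewrite -sumE.
by under eq_bigr => i _ do rewrite -xE.
Qed.

(** * Degree and limit *)

Theorem proposition4p4 (R : realType) (n : nat) (n_gt0 : (0 < n)%N) :
  (forall k : nat, (0 < k)%N ->
    delta (integer_points R n `&`
           interior (dilate k%:R (centered_simplex R n)))
    = (n.+1 * k - n)%N) /\
  ((delta (integer_points R n `&`
           interior (dilate k%:R (centered_simplex R n))))%:R / k%:R : R)
    @[k --> \oo] --> (n.+1%:R : R).
Proof.
have deltaE k : (0 < k)%N ->
    delta (integer_points R n `&`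
           interior (dilate k%:R (centered_simplex R n))) = (n.+1 * k - n)%N.
  case: k => // k _.
  rewrite (@delta_lattice_simplex _ _ (n.+1 * k) (fun _ j => j%:R - k%:R)) //.
  - by rewrite mulnS addSn -addnS addKn.
  - by move=> _ i j /addIr/eqP; rewrite eqr_nat => /eqP.
  - by move=> x; apply: integer_interiorP.
split=> //.
have inv_cvg0 : (k%:R^-1 : R) @[k --> \oo] --> (0 : R).
  apply/(@gtr0_cvgV0 R nat \oo _ (fun k => k%:R)); last exact: cvgr_idn.
  by near=> k; rewrite ltr0n; near: k; exact: nbhs_infty_gt.
have lim_cvg : (n.+1%:R - n%:R * k%:R^-1 : R) @[k --> \oo] --> (n.+1%:R : R).
  rewrite -[X in _ --> X]subr0 -[X in _ - X](mulr0 n%:R).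
  by apply: cvgB; [exact: cvg_cst | apply: cvgM; [exact: cvg_cst|]].
apply: cvg_trans lim_cvg; apply: near_eq_cvg; near=> k.
have k_gt0 : (0 < k)%N by near: k; exact: nbhs_infty_gt.
rewrite deltaE // natrB; last first.
  by rewrite mulSn (leq_trans (leq_pmulr n k_gt0)) // leq_addl.
by rewrite mulrBl natrM mulfK // pnatr_eq0 -lt0n.
Unshelve. all: by end_near.
Qed.
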